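(* Let $\mathcal{A}^D_{\hbar,1}(\mathcal{F})$ be a shift algebra (with $q=1$), let $c_1,\ldots,c_D\in\mathbb{R}$, and assume $\sqrt{u_i+c_i}\in\mathcal{F}$ for $i=1,\ldots,D$. Let $\mathfrak{g}$ be a finite dimensional Lie algebra with basis $\{X^a\}_{a=1}^n$ such that $[X^a,X^b]=\sum_{c=1}^n f^{ab}{}_c X^c$, and let $(X^a_{ij})_{i,j=1}^N$ denote the matrices of an $N$-dimensional representation of $\mathfrak{g}$, where $N\le D$. Then the elements $$\hat X^a=\sum_{i,j=1}^N X^a_{ij}\,\sqrt{u_i+c_i}\;U_i^{-1}U_j\,\sqrt{u_j+c_j}$$ of $\mathcal{A}^D_{\hbar,1}(\mathcal{F})$ satisfy $[\hat X^a,\hat X^b]=\hbar\sum_{c=1}^n f^{ab}{}_c\hat X^c$ for all $a,b=1,\ldots,n$.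
   Context: $F(\mathbb{R}^D,\mathbb{C})$ is the $\ast$-algebra of all complex valued functions of $u=(u_1,\ldots,u_D)\in\mathbb{R}^D$ (involution = complex conjugation). For $\hbar>0$, $k\in\mathbb{Z}^D$ put $(S_\hbar^kf)(u)=f(u+k\hbar)$. A $\ast$-subalgebra $\mathcal{F}\subseteq F(\mathbb{R}^D,\mathbb{C})$ is $\hbar$-invariant if $S_\hbar^kf\in\mathcal{F}$ for all $f\in\mathcal{F}$, $k\in\mathbb{Z}^D$. Shift algebra with $q=1$: for $\hbar>0$ and $\mathcal{F}$ $\hbar$-invariant, $\mathcal{A}^D_{\hbar,1}(\mathcal{F})$ consists of finite formal sums $\sum_{k\in\mathbb{Z}^D}f_kU^k$ with $f_k\in\mathcal{F}$, where $U^k=U_1^{k_1}\cdots U_D^{k_D}$, with product $(\sum_kf_kU^k)(\sum_lg_lU^l)=\sum_{k,l}f_k(S_\hbar^kg_l)U^{k+l}$. Thus the $U_i$ commute with each other and $U_ig=(S_\hbar^{e_i}g)U_i$ for $g\in\mathcal{F}$ ($e_i$ the $i$-th unit vector). Convention: for real $x<0$, $\sqrt{x}=i\sqrt{|x|}$, so $\sqrt{u_i+c_i}$ is a function on all of $\mathbb{R}^D$ whose square is $u_i+c_i$. The Lie algebra is over $\mathbb{R}$ or $\mathbb{C}$ and the representation matrices are complex, satisfying $X^aX^b-X^bX^a=\sum_cf^{ab}{}_cX^c$ as matrices. *)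

(* Defs.v *)
From HB Require Import structures.
From mathcomp Require Import all_boot all_order all_algebra finmap.
From mathcomp Require Import complex monalg.
From mathcomp Require Import boolp classical_sets functions reals.

Set Implicit Arguments.
Unset Strict Implicit.
Unset Printing Implicit Defensive.

Import Order.TTheory GRing.Theory Num.Theory.
Local Open Scope ring_scope.

Notation cfun R D := ('rV[R]_D -> R[i]).

Section Functions.
Context (R : realType) (D : nat).
Implicit Types (f g : cfun R D) (k l : 'rV[int]_D).

Definition shift (hbar : R) k f : cfun R D :=
  fun u => f (u + hbar *: map_mx intr k).

(* No unit is required: a *-subalgebra need not contain the constants. *)
Record star_subalgebra (F : set (cfun R D)) : Prop := StarSubalgebra {
  star_subalgebra0 : F 0;
  star_subalgebraD : forall f g, F f -> F g -> F (f + g);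
  star_subalgebraZ : forall (z : R[i]) f, F f -> F (cst z * f);
  star_subalgebraM : forall f g, F f -> F g -> F (f * g);
  star_subalgebraJ : forall f, F f -> F (fun u => conjc (f u))
}.

Definition shift_invariant (hbar : R) (F : set (cfun R D)) : Prop :=
  forall f k, F f -> F (shift hbar k f).

Definition csqrt (x : R) : R[i] :=
  if 0 <= x then Complex (Num.sqrt x) 0 else Complex 0 (Num.sqrt `|x|).

Definition sqrt_coord (c : R) (i : 'I_D) : cfun R D :=
  fun u => csqrt (u 0 i + c).

Lemma csqrtK (x : R) : csqrt x * csqrt x = (x%:C)%C.
Proof.
rewrite /csqrt; case: ifPn => [x0|]; last rewrite -ltNge => x0;
  apply/eqP; rewrite eq_complex /=; apply/andP; split; apply/eqP;
  rewrite ?mulr0 ?mul0r ?subr0 ?sub0r ?addr0 //.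
  by rewrite -expr2 sqr_sqrtr.
by rewrite -expr2 sqr_sqrtr // ltr0_norm ?opprK.
Qed.

Lemma shift0 hbar f : shift hbar 0 f = f.
Proof. by apply/funext => u; rewrite /shift map_mx0 scaler0 addr0. Qed.

Lemma shiftA hbar k l f : shift hbar k (shift hbar l f) = shift hbar (k + l) f.
Proof. by apply/funext => u; rewrite /shift map_mxD scalerDr addrA. Qed.

Lemma shiftD hbar k f g : shift hbar k (f + g) = shift hbar k f + shift hbar k g.
Proof. by []. Qed.

Lemma shiftM hbar k f g : shift hbar k (f * g) = shift hbar k f * shift hbar k g.
Proof. by []. Qed.

Lemma shift_fun0 hbar k : shift hbar k 0 = 0. Proof. by []. Qed.

Lemma shift_cst hbar k (z : R[i]) : shift hbar k (cst z) = cst z.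
Proof. by []. Qed.

End Functions.

(* The shift algebra (q = 1) over all of F(R^D, C): finitely supported families
   (f_k) indexed by k in Z^D, standing for the formal sums \sum_k f_k U^k. The
   alias carries hbar because the twisted product below depends on it. *)
Definition shift_ring (R : realType) (D : nat) (hbar : R) : Type :=
  {malg (cfun R D)['rV[int]_D]}.

HB.instance Definition _ (R : realType) (D : nat) (hbar : R) :=
  GRing.Zmodule.copy (shift_ring D hbar) {malg (cfun R D)['rV[int]_D]}.

(* f U^k; locked, as unification otherwise unfolds the monoid-algebra code. *)
HB.lock Definition monom (R : realType) (D : nat) (hbar : R)
  (f : cfun R D) (k : 'rV[int]_D) : shift_ring D hbar := << f *g k >>.
Canonical monom_unlockable := Unlockable monom.unlock.
Arguments monom {R D hbar} f k.

HB.lock Definition coeff (R : realType) (D : nat) (hbar : R)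
  (a : shift_ring D hbar) (k : 'rV[int]_D) : cfun R D := mcoeff k a.
Canonical coeff_unlockable := Unlockable coeff.unlock.
Arguments coeff {R D hbar} a k.

Section ShiftRing.
Context (R : realType) (D : nat) (hbar : R).
Local Notation A := (shift_ring D hbar).
Local Notation S := (shift hbar).
Implicit Types (a b : A) (f g : cfun R D) (k l : 'rV[int]_D) (z : R[i]).

Definition shift_one : A := monom 1 0.

Definition shift_mul a b : A :=
  \sum_(k <- msupp a) \sum_(l <- msupp b)
    monom (coeff a k * S k (coeff b l)) (k + l).

Definition shift_scale z a : A :=
  \sum_(k <- msupp a) monom (cst z * coeff a k) k.

Local Open Scope fset_scope.
Local Open Scope ring_scope.

Lemma shift_mulw (d1 d2 : {fset 'rV[int]_D}) a b :
  msupp a `<=` d1 -> msupp b `<=` d2 ->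
  shift_mul a b = \sum_(k <- d1) \sum_(l <- d2)
    monom (coeff a k * S k (coeff b l)) (k + l).
Proof.
move=> le_d1 le_d2; rewrite /shift_mul (big_fset_incl _ le_d1) /=.
  apply/eq_bigr=> k1 _; apply/big_fset_incl => // k _ kn.
  by rewrite !unlock (mcoeff_outdom kn) shift_fun0 mulr0 monalgU0.
move=> k _ kn; rewrite big1 // => k' _.
by rewrite !unlock (mcoeff_outdom kn) mul0r monalgU0.
Qed.

Lemma monomD k : {morph (fun f => monom f k : A) : f g / f + g}.
Proof. by move=> f g; rewrite !unlock monalgUD. Qed.

Lemma coeffD k : {morph (fun a : A => coeff a k) : a b / a + b}.
Proof. by move=> a b; rewrite !unlock mcoeffD. Qed.

Lemma coeff0 k : coeff (0 : A) k = 0.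
Proof. by rewrite unlock mcoeff0. Qed.

Lemma coeff_sum (I : Type) (r : seq I) (F : I -> A) k :
  coeff (\sum_(i <- r) F i) k = \sum_(i <- r) coeff (F i) k.
Proof. exact: (big_morph (fun a : A => coeff a k) (coeffD k) (coeff0 k)). Qed.

Lemma coeff_monom f k l : coeff (monom f k : A) l = f *+ (k == l).
Proof. by rewrite !unlock mcoeffU. Qed.

Lemma shift_mulDl : left_distributive shift_mul +%R.
Proof.
move=> a b g.
rewrite [in LHS](@shift_mulw _ _ (a + b) g (msuppD_le a b) (fsubset_refl _)).
rewrite (shift_mulw (fsubsetUl _ (msupp b)) (fsubset_refl _)).
rewrite (shift_mulw (fsubsetUr (msupp a) _) (fsubset_refl _)).
rewrite -big_split /=; apply/eq_bigr=> k1 _.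
rewrite -big_split /=; apply/eq_bigr=> k2 _.
by rewrite coeffD mulrDl monomD.
Qed.

Lemma shift_mulDr : right_distributive shift_mul +%R.
Proof.
move=> g a b.
rewrite [in LHS](@shift_mulw _ _ g (a + b) (fsubset_refl _) (msuppD_le a b)).
rewrite (shift_mulw (fsubset_refl _) (fsubsetUl _ (msupp b))).
rewrite (shift_mulw (fsubset_refl _) (fsubsetUr (msupp a) _)).
rewrite -big_split /=; apply/eq_bigr=> k1 _.
rewrite -big_split /=; apply/eq_bigr=> k2 _.
by rewrite coeffD shiftD mulrDr monomD.
Qed.

Lemma shift_mul0l : left_zero 0 shift_mul.
Proof. by move=> a; rewrite /shift_mul msupp0 big_seq_fset0. Qed.

Lemma shift_mul0r : right_zero 0 shift_mul.
Proof.
by move=> a; rewrite /shift_mul big1 // => k _; rewrite msupp0 big_seq_fset0.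
Qed.

Lemma shift_mul_suml (I : Type) (r : seq I) (F : I -> A) b :
  shift_mul (\sum_(i <- r) F i) b = \sum_(i <- r) shift_mul (F i) b.
Proof.
exact: (big_morph (shift_mul^~ b) (fun _ _ => shift_mulDl _ _ _) (shift_mul0l _)).
Qed.

Lemma shift_mul_sumr (I : Type) (r : seq I) (F : I -> A) b :
  shift_mul b (\sum_(i <- r) F i) = \sum_(i <- r) shift_mul b (F i).
Proof.
exact: (big_morph (shift_mul b) (fun _ _ => shift_mulDr _ _ _) (shift_mul0r _)).
Qed.

Lemma shift_mulUU f g k l :
  shift_mul (monom f k) (monom g l) = monom (f * S k g) (k + l).
Proof.
have e h m : msupp (monom h m : A) `<=` [fset m].
  by rewrite unlock; exact: msuppU_le.
by rewrite (shift_mulw (e _ _) (e _ _)) !big_seq_fset1 !coeff_monom !eqxx !mulr1n.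
Qed.

Lemma shift_ringE a : a = \sum_(k <- msupp a) monom (coeff a k) k.
Proof. by rewrite [LHS]monalgE; apply/eq_bigr => k _; rewrite !unlock. Qed.

Lemma shift_mulA : associative shift_mul.
Proof.
move=> a b c; rewrite (shift_ringE a) !shift_mul_suml; apply/eq_bigr=> k _.
rewrite (shift_ringE b) shift_mul_suml !shift_mul_sumr shift_mul_suml.
apply/eq_bigr=> l _; rewrite (shift_ringE c) !shift_mul_sumr.
apply/eq_bigr=> m _.
by rewrite !shift_mulUU shiftM shiftA mulrA addrA.
Qed.

Lemma shift_mul1l : left_id shift_one shift_mul.
Proof.
move=> a; rewrite (shift_ringE a) shift_mul_sumr; apply/eq_bigr=> k _.
by rewrite shift_mulUU shift0 mul1r add0r.
Qed.

Lemma shift_mul1r : right_id shift_one shift_mul.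
Proof.
move=> a; rewrite (shift_ringE a) shift_mul_suml; apply/eq_bigr=> k _.
by rewrite shift_mulUU [S k 1]shift_cst mulr1 addr0.
Qed.

HB.instance Definition _ := GRing.Zmodule_isPzRing.Build A
  shift_mulA shift_mul1l shift_mul1r shift_mulDl shift_mulDr.

Lemma coeff_scale z a k : coeff (shift_scale z a) k = cst z * coeff a k.
Proof.
rewrite [in RHS](shift_ringE a) !coeff_sum mulr_sumr.
by apply/eq_bigr=> i _; rewrite !coeff_monom mulrnAr.
Qed.

Lemma shift_ringP a b : (forall k, coeff a k = coeff b k) -> a = b.
Proof. by rewrite unlock => h; apply/malgP. Qed.

Lemma shift_scaleA z w a :
  shift_scale z (shift_scale w a) = shift_scale (z * w) a.
Proof. by apply/shift_ringP => k; rewrite !coeff_scale mulrA. Qed.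

Lemma shift_scale1 : left_id 1 shift_scale.
Proof. by move=> a; apply/shift_ringP => k; rewrite coeff_scale mul1r. Qed.

Lemma shift_scaleDr : right_distributive shift_scale +%R.
Proof.
by move=> z a b; apply/shift_ringP => k; rewrite coeffD !coeff_scale coeffD mulrDr.
Qed.

Lemma shift_scaleDl a : {morph shift_scale^~ a : z w / z + w}.
Proof.
by move=> z w; apply/shift_ringP => k; rewrite coeffD !coeff_scale -mulrDl.
Qed.

HB.instance Definition _ := GRing.Zmodule_isLmodule.Build R[i] A
  shift_scaleA shift_scale1 shift_scaleDr shift_scaleDl.

Definition of_fun f : A := monom f 0.

Definition U k : A := monom 1 k.

Definition unit_vec (i : 'I_D) : 'rV[int]_D := delta_mx 0 i.

Definition Ugen i : A := U (unit_vec i).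
Definition Uinv i : A := U (- unit_vec i).

(* A^D_{hbar,1}(F) as a subset of the full shift algebra: the formal sums all of
   whose coefficients lie in F. *)
Definition shift_algebra (F : set (cfun R D)) : set A :=
  fun a => forall k, F (coeff a k).

Lemma shift_mulE a b : a * b = shift_mul a b. Proof. by []. Qed.

Lemma scale_monom z f k : z *: monom f k = monom (cst z * f) k.
Proof.
apply/shift_ringP => l.
by rewrite [LHS]coeff_scale !coeff_monom mulrnAr.
Qed.

Lemma monomE f k : monom f k = of_fun f * U k.
Proof. by rewrite shift_mulE shift_mulUU shift0 mulr1 add0r. Qed.

Lemma UD k l : U k * U l = U (k + l).
Proof. by rewrite shift_mulE shift_mulUU mul1r [S k 1]shift_cst. Qed.

Lemma U_fun k f : U k * of_fun f = of_fun (S k f) * U k.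
Proof. by rewrite -monomE shift_mulE shift_mulUU mul1r addr0. Qed.

Lemma UgenK i : Ugen i * Uinv i = 1.
Proof. by rewrite UD subrr. Qed.

Lemma UinvK i : Uinv i * Ugen i = 1.
Proof. by rewrite UD addNr. Qed.

Lemma shift_scaleAl z a b : z *: (a * b) = (z *: a) * b.
Proof.
have e c : z *: c = of_fun (cst z) * c.
  rewrite (shift_ringE c) mulr_sumr scaler_sumr; apply/eq_bigr => k _.
  by rewrite scale_monom shift_mulE shift_mulUU shift0 add0r.
by rewrite !e mulrA.
Qed.

Lemma shift_scaleAr z a b : z *: (a * b) = a * (z *: b).
Proof.
rewrite (shift_ringE a) (shift_ringE b) !mulr_suml !scaler_sumr.
apply/eq_bigr => k _; rewrite !mulr_sumr scaler_sumr; apply/eq_bigr => l _.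
rewrite [in RHS]scale_monom !shift_mulE !shift_mulUU scale_monom.
by rewrite shiftM shift_cst mulrCA.
Qed.

Section Subalgebra.
Context (F : set (cfun R D)).
Hypotheses (Fstar : star_subalgebra F) (Fshift : shift_invariant hbar F).

Lemma shift_algebra0 : shift_algebra F 0.
Proof. by move=> k; rewrite coeff0; exact: star_subalgebra0. Qed.

Lemma shift_algebraD a b :
  shift_algebra F a -> shift_algebra F b -> shift_algebra F (a + b).
Proof. by move=> Fa Fb k; rewrite coeffD; apply: star_subalgebraD. Qed.

Lemma shift_algebraZ z a : shift_algebra F a -> shift_algebra F (z *: a).
Proof. by move=> Fa k; rewrite coeff_scale; apply: star_subalgebraZ. Qed.

Lemma shift_algebra_monom f k : F f -> shift_algebra F (monom f k).
Proof.
move=> Ff l; rewrite coeff_monom; case: eqP => // _.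
exact: star_subalgebra0.
Qed.

Lemma shift_algebra_sum (I : Type) (r : seq I) (G : I -> A) :
  (forall i, shift_algebra F (G i)) -> shift_algebra F (\sum_(i <- r) G i).
Proof.
by move=> FG; apply: big_ind => //; [exact: shift_algebra0 | exact: shift_algebraD].
Qed.

Lemma shift_algebraM a b :
  shift_algebra F a -> shift_algebra F b -> shift_algebra F (a * b).
Proof.
move=> Fa Fb; rewrite shift_mulE /shift_mul.
apply: shift_algebra_sum => k; apply: shift_algebra_sum => l.
by apply: shift_algebra_monom; apply: star_subalgebraM => //; apply: Fshift.
Qed.

End Subalgebra.

(* \sum_(i, j <= N) M_ij sqrt(u_i + c_i) U_i^-1 U_j sqrt(u_j + c_j), where
   widen_ord identifies an index i <= N with the same index in 1..D. *)
Definition hat (c : 'I_D -> R) (N : nat) (leND : (N <= D)%N) (M : 'M[R[i]]_N) : A :=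
  \sum_(i < N) \sum_(j < N)
    let i' := widen_ord leND i in let j' := widen_ord leND j in
    M i j *: (of_fun (sqrt_coord (c i') i') * Uinv i' * Ugen j'
              * of_fun (sqrt_coord (c j') j')).

End ShiftRing.

Variant ground := GroundReal | GroundComplex.

Definition ground_field (R : realType) (s : ground) : fieldType :=
  match s with GroundReal => R | GroundComplex => R[i] end.

Definition to_complex (R : realType) (s : ground) : ground_field R s -> R[i] :=
  match s with
  | GroundReal => fun x : R => (x%:C)%C
  | GroundComplex => fun x : R[i] => x
  end.

Record lie_bracket (K : fieldType) (L : lmodType K) (br : L -> L -> L) : Prop :=
  LieBracket {
    lie_bracketPl : forall (t : K) x y z, br (t *: x + y) z = t *: br x z + br y z;
    lie_bracketPr : forall (t : K) x y z, br z (t *: x + y) = t *: br z x + br z y;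
    lie_bracketxx : forall x, br x x = 0;
    lie_bracketJ : forall x y z,
      br x (br y z) + br y (br z x) + br z (br x y) = 0
  }.

Record lie_representation (R : realType) (s : ground)
    (L : lmodType (ground_field R s)) (br : L -> L -> L)
    (N : nat) (rho : L -> 'M[R[i]]_N) : Prop := LieRepresentation {
  lie_representationP : forall (t : ground_field R s) x y,
    rho (t *: x + y) = to_complex t *: rho x + rho y;
  lie_representation_br : forall x y,
    rho (br x y) = rho x *m rho y - rho y *m rho x
}.

(* Main.v *)
Require Import Defs.
From HB Require Import structures.
From mathcomp Require Import all_boot all_order all_algebra.
From mathcomp Require Import complex.
From mathcomp Require Import boolp classical_sets functions reals.

(** The elements [a_i^+ = sqrt(u_i + c_i) U_i^-1] and [a_i = U_i sqrt(u_i + c_i)]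
    satisfy the canonical commutation relations [[a_i, a_j^+] = hbar delta_ij],
    all other commutators being zero.  Hence [hat M = \sum_ij M_ij a_i^+ a_j] is
    the Jordan-Schwinger map: moving annihilators to the right gives
    [hat M * hat M' = :hat M hat M': + hbar hat (M M')], and the normally ordered
    term is symmetric in [M] and [M'], so it drops out of the commutator. *)

Set Implicit Arguments.
Unset Strict Implicit.
Unset Printing Implicit Defensive.

Import Order.TTheory GRing.Theory Num.Theory.
Local Open Scope ring_scope.

Section JordanSchwinger.
Context (R : realType) (D : nat) (hbar : R) (c : 'I_D -> R).
Local Notation A := (shift_ring D hbar).
Implicit Types (i j : 'I_D) (k : 'rV[int]_D) (x y : R).

Definition creation i : A := of_fun hbar (sqrt_coord (c i) i) * Uinv hbar i.
Definition annihilation i : A := Ugen hbar i * of_fun hbar (sqrt_coord (c i) i).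

(** A translation reaches the root only through [u_i], so the constant under the root absorbs it.
    The commutation relations below thus reduce to comparing such constants. *)
Lemma shift_sqrt_coord k x i :
  shift hbar k (sqrt_coord x i) = sqrt_coord (x + hbar * (k 0 i)%:~R) i.
Proof.
by apply/funext => u; rewrite /shift /sqrt_coord !mxE -addrA [X in _ + X]addrC.
Qed.

Lemma monomM (g h : cfun R D) k l :
  monom g k * monom h l = monom (g * shift hbar k h) (k + l) :> A.
Proof. by rewrite shift_mulE shift_mulUU. Qed.

Lemma unit_vecE i j : unit_vec i 0 j = (i == j)%:R.
Proof. by rewrite mxE eqxx eq_sym. Qed.

Lemma creationE i : creation i = monom (sqrt_coord (c i) i) (- unit_vec i).
Proof. by rewrite /creation /Uinv -monomE. Qed.

Lemma annihilationE i :
  annihilation i = monom (sqrt_coord (c i + hbar) i) (unit_vec i).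
Proof.
by rewrite /annihilation /Ugen U_fun -monomE shift_sqrt_coord unit_vecE eqxx mulr1.
Qed.

Lemma creationC i j : creation i * creation j = creation j * creation i.
Proof.
have [-> //|ij] := eqVneq i j.
rewrite !creationE !monomM !shift_sqrt_coord ![(- unit_vec _) 0 _]mxE !unit_vecE.
by rewrite (negPf ij) eq_sym (negPf ij) oppr0 mulr0 !addr0 mulrC addrC.
Qed.

Lemma annihilationC i j :
  annihilation i * annihilation j = annihilation j * annihilation i.
Proof.
have [-> //|ij] := eqVneq i j.
rewrite !annihilationE !monomM !shift_sqrt_coord !unit_vecE.
by rewrite (negPf ij) eq_sym (negPf ij) mulr0 !addr0 mulrC [unit_vec i + _]addrC.
Qed.

Lemma sqrt_coordK x i :
  sqrt_coord x i * sqrt_coord x i = fun u => ((u 0 i + x)%:C)%C.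
Proof. by apply/funext => u; exact: csqrtK. Qed.

Lemma annihilation_creation i j :
  annihilation i * creation j =
  creation j * annihilation i + ((hbar%:C)%C * (i == j)%:R) *: (1 : A).
Proof.
rewrite annihilationE creationE !monomM !shift_sqrt_coord [(- unit_vec _) 0 _]mxE !unit_vecE.
rewrite [unit_vec i + _]addrC.
have [<-|_] := eqVneq i j; last first.
  by rewrite oppr0 !mulr0 !addr0 scale0r addr0 mulrC.
(* For [i = j] both products have degree 0 and two equal roots: they are the functions
   [u_i + c_i + hbar] and [u_i + c_i], whatever the sign under the root. *)
rewrite mulr1 mulrN1 addrK addNr mulr1 !sqrt_coordK.
rewrite [1 in RHS](_ : 1 = monom 1 0 :> A) // scale_monom -monomD.
congr monom; apply/funext => u /=.
by rewrite addrA rmorphD /= [RHS]/GRing.add /= [in RHS]/GRing.mul /= mulr1.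
Qed.

Section Hat.
Context (N : nat) (leND : (N <= D)%N).
Local Notation w := (widen_ord leND).
Local Notation hat := (hat hbar c leND).
Implicit Types (M : 'M[R[i]]_N) (z : R[i]).

Lemma hatE M :
  hat M = \sum_i \sum_j M i j *: (creation (w i) * annihilation (w j)).
Proof.
apply: eq_bigr => i _; apply: eq_bigr => j _ /=.
by rewrite /creation /annihilation !mulrA.
Qed.

Lemma hat_is_linear z M M' : hat (z *: M + M') = z *: hat M + hat M'.
Proof.
rewrite !hatE scaler_sumr -big_split; apply: eq_bigr => i _ /=.
rewrite scaler_sumr -big_split; apply: eq_bigr => j _ /=.
by rewrite !mxE scalerDl scalerA.
Qed.

HB.instance Definition _ := GRing.isLinear.Build R[i] 'M[R[i]]_N A _ hat hat_is_linear.

Definition normal_product M M' : A :=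
  \sum_i \sum_j \sum_k \sum_l (M i j * M' k l) *:
    (creation (w i) * creation (w k) * (annihilation (w j) * annihilation (w l))).

Lemma normal_productC M M' : normal_product M M' = normal_product M' M.
Proof.
(* Packing the indices as [(i, j)] and [(k, l)] lets one exchange of sums swap the roles of [M] and
   [M']. *)
rewrite /normal_product pair_big /=.
under eq_bigr => p _ do rewrite pair_big /=.
under [RHS]eq_bigr => i _ do under eq_bigr => j _ do rewrite pair_big /=.
rewrite [RHS]pair_big exchange_big /=.
apply: eq_bigr => p _; apply: eq_bigr => q _.
by rewrite mulrC creationC annihilationC.
Qed.

Lemma hatM M M' :
  hat M * hat M' = normal_product M M' + (hbar%:C)%C *: hat (M *m M').
Proof.
(* The Kronecker delta spreads the matrix product over the same four indices as [hat M * hat M'], so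
   that the rest is a comparison term by term. *)
have -> : hat (M *m M') = \sum_i \sum_j \sum_k \sum_l (M i j * M' k l) *:
    ((j == k)%:R *: (creation (w i) * annihilation (w l))).
  rewrite hatE; apply: eq_bigr => i _; rewrite exchange_big /=.
  under eq_bigr => l _ do rewrite mxE scaler_suml.
  under [RHS]eq_bigr => k _ do rewrite exchange_big /=.
  rewrite [RHS]exchange_big; apply: eq_bigr => l _; apply: eq_bigr => k _.
  rewrite (bigD1 k) //= eqxx scale1r big1 ?addr0 // => j /negPf ->.
  by rewrite scale0r scaler0.
rewrite !hatE mulr_suml /normal_product [in RHS]scaler_sumr -big_split; apply: eq_bigr => i _ /=.
rewrite mulr_suml [in RHS]scaler_sumr -big_split; apply: eq_bigr => j _ /=.
rewrite mulr_sumr [in RHS]scaler_sumr -big_split; apply: eq_bigr => k _ /=.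
rewrite mulr_sumr [in RHS]scaler_sumr -big_split; apply: eq_bigr => l _ /=.
rewrite -shift_scaleAl -shift_scaleAr scalerA.
(* Only the middle pair is out of normal order; commuting it yields the delta term. *)
rewrite [X in _ *: X = _](_ : _ = creation (w i) *
  (annihilation (w j) * creation (w k)) * annihilation (w l)); last first.
  by rewrite !mulrA.
rewrite annihilation_creation mulrDr mulrDl scalerDr (_ : (w j == w k) = (j == k)) //.
rewrite -!shift_scaleAr -!shift_scaleAl mulr1 !mulrA; congr (_ + _).
by rewrite !scalerA mulrCA -[in RHS]mulrA.
Qed.

Lemma hat_commutator M M' :
  hat M * hat M' - hat M' * hat M = (hbar%:C)%C *: hat (M *m M' - M' *m M).
Proof.
by rewrite !hatM normal_productC opprD addrACA subrr add0r -scalerBr -raddfB.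
Qed.

(** As [F] may lack the constant 1, the bare [U_i] may lie outside the algebra. Each ladder operator
    is therefore taken as one monomial, with a root or a shifted root as coefficient. *)
Lemma shift_algebra_hat (F : set (cfun R D)) M :
  star_subalgebra F -> shift_invariant hbar F ->
  (forall i, F (sqrt_coord (c i) i)) -> shift_algebra F (hat M).
Proof.
move=> Fstar Fshift Fsqrt; rewrite hatE.
apply: shift_algebra_sum => // i; apply: shift_algebra_sum => // j.
apply: shift_algebraZ => //; apply: shift_algebraM => //.
  by rewrite creationE; apply: shift_algebra_monom.
rewrite /annihilation /Ugen U_fun -monomE.
by apply: shift_algebra_monom => //; apply: Fshift.
Qed.

End Hat.
End JordanSchwinger.

(** Over a real Lie algebra [rho] is linear only along the embedding [to_complex], hence a direct
    induction on the sum. *)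
Lemma lie_representation_sum (R : realType) (s : ground)
    (L : lmodType (ground_field R s)) (br : L -> L -> L) (N : nat)
    (rho : L -> 'M[R[i]]_N) (I : Type) (r : seq I)
    (t : I -> ground_field R s) (x : I -> L) :
  lie_representation br rho ->
  rho (\sum_(e <- r) t e *: x e) = \sum_(e <- r) to_complex (t e) *: rho (x e).
Proof.
move=> [rhoP _]; elim: r => [|e r IHr]; last by rewrite !big_cons rhoP IHr.
(* This instance reads [rho 0 = rho 0 + rho 0], which forces [rho 0 = 0]. *)
rewrite !big_nil; have := rhoP 1 0 0.
have -> : to_complex (1 : ground_field R s) = 1 by case: (s).
by rewrite !scale1r addr0 => /esym /(canRL (addrK _)); rewrite subrr.
Qed.

Theorem proposition5p2
  (R : realType) (D : nat) (hbar : R) (hbar_gt0 : 0 < hbar)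
  (F : set (cfun R D))
  (F_star : star_subalgebra F) (F_inv : shift_invariant hbar F)
  (c : 'I_D -> R) (F_sqrt : forall i : 'I_D, F (sqrt_coord (c i) i))
  (s : ground) (L : vectType (ground_field R s))
  (br : L -> L -> L) (br_lie : lie_bracket br)
  (n : nat) (X : n.-tuple L) (X_basis : basis_of fullv X)
  (f : 'I_n -> 'I_n -> 'I_n -> ground_field R s)
  (X_br : forall a b : 'I_n,
     br (tnth X a) (tnth X b) = \sum_(e < n) f a b e *: tnth X e)
  (N : nat) (leND : (N <= D)%N)
  (rho : L -> 'M[R[i]]_N) (rho_rep : lie_representation br rho) :
  let Xhat (a : 'I_n) : shift_ring D hbar := hat hbar c leND (rho (tnth X a)) in
  (forall a : 'I_n, shift_algebra F (Xhat a)) /\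
  (forall a b : 'I_n,
     Xhat a * Xhat b - Xhat b * Xhat a
     = (hbar%:C)%C *: \sum_(e < n) to_complex (f a b e) *: Xhat e).
Proof.
move=> Xhat; split=> [a|a b]; first exact: shift_algebra_hat.
(* The matrix commutator is [rho] of a bracket of basis vectors; its expansion passes through [rho]
   and then [hat] by linearity. *)
rewrite /Xhat hat_commutator -(lie_representation_br rho_rep) X_br.
rewrite (lie_representation_sum _ _ _ rho_rep) [hat _ _ _ _]linear_sum /=.
by congr (_ *: _); apply: eq_bigr => e _; rewrite linearZ.
Qed.
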